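(* Let $G$ be a graph and let $v,w$ be two distinct vertices of $G$ such that $H=G\setminus\{v,w\}$ is an anchor of $G$. Write $s_v=N(v)\cap V(H)$ and $s_w=N(w)\cap V(H)$. Suppose that the distance of $v$ and $w$ within $H$ specifies the relative position of $s_v$ and $s_w$ in $H$, i.e. that the following holds: whenever $A,B\subseteq V(H)$ are such that $A=\alpha(s_v)$ and $B=\beta(s_w)$ for some $\alpha,\beta\in\mathrm{Aut}(H)$ and $\delta_H(A,B)=\delta_H(s_v,s_w)$, there exists $\tau\in\mathrm{Aut}(H)$ that maps the pair $\{A,B\}$ to the pair $\{s_v,s_w\}$ (as unordered pairs, i.e. as multisets of subsets of $V(H)$). Then $G$ is reconstructible.
   Context: All graphs are finite and simple. For $X\subseteq V(G)$, $G\setminus X$ denotes the induced subgraph of $G$ on $V(G)-X$, and $N(v)$ is the set of neighbors of $v$ in $G$. An anchor of $G$ is a nonempty proper induced subgraph $H$ of $G$ that occurs exactly once in $G$, i.e. no other subset of $V(G)$ induces a subgraph isomorphic to $H$. For $A,B\subseteq V(H)$, put $\delta_H(A,B)=2+\min\{d_H(a,b): a\in A,\ b\in B\}$, where $d_H$ is the graph distance in $H$, with $\delta_H(A,B)=\infty$ if no path of $H$ (including paths of length $0$) joins a vertex of $A$ to a vertex of $B$. Thus $\delta_H(s_v,s_w)$ is the distance of $v$ and $w$ within $H$: the length of a shortest path from $v$ to $w$ with at least one interior vertex and all interior vertices in $V(H)$ (a possible edge $vw$ is ignored). The deck of $G$ is the multiset of isomorphism types of the graphs $G\setminus\{x\}$,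 $x\in V(G)$. $G$ is reconstructible if every graph with the same deck as $G$ is isomorphic to $G$. *)

(* Defs.v *)
From HB Require Import structures.
From mathcomp Require Import all_boot.
From mathcomp Require Import perm.

Set Implicit Arguments.
Unset Strict Implicit.
Unset Printing Implicit Defensive.

Record sgraph := SGraph {
  svertex :> finType;
  edge : rel svertex;
  edge_sym : symmetric edge;
  edge_irrefl : irreflexive edge
}.

Section Induced.
Variables (G : sgraph) (S : {set G}).

Definition induced_edge : rel {x : G | x \in S} :=
  fun x y => edge (val x) (val y).

Lemma induced_edge_sym : symmetric induced_edge.
Proof. by move=> x y; apply: edge_sym. Qed.

Lemma induced_edge_irrefl : irreflexive induced_edge.
Proof. by move=> x; apply: edge_irrefl. Qed.

Definition induced : sgraph := SGraph induced_edge_sym induced_edge_irrefl.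

End Induced.

Definition del (G : sgraph) (X : {set G}) : sgraph := induced (~: X).

Definition isomorphic (G H : sgraph) : bool :=
  [exists f : {ffun G -> H},
    [&& injectiveb f, [forall y, y \in codom f]
      & [forall x, forall y, edge (f x) (f y) == edge x y]]].

Lemma isomorphicP (G H : sgraph) :
  reflect (exists2 f : G -> H, bijective f & {mono f : x y / edge x y})
          (isomorphic G H).
Proof.
apply: (iffP existsP) => [[f /and3P[/injectiveP fI /forallP fS /forallP fE]]|].
  exists f; last by move=> x y; apply/eqP/(forallP (fE x)).
  exists (fun y => iinv (fS y)) => [x | y]; last exact: f_iinv.
  by apply: fI; apply: f_iinv.
move=> [f fB fE]; exists (finfun f); apply/and3P; split.
- by apply/injectiveP => x y; rewrite !ffunE; apply: bij_inj.
- apply/forallP => y; have [g fK gK] := fB.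
  by apply/codomP; exists (g y); rewrite ffunE gK.
- by apply/forallP => x; apply/forallP => y; rewrite !ffunE fE.
Qed.

Definition anchor (G : sgraph) (S : {set G}) : Prop :=
  [/\ S != set0, S \proper [set: G]
    & forall S' : {set G}, isomorphic (induced S') (induced S) -> S' = S].

(* A multiset of isomorphism types is given by its multiplicity function;
   types are represented by arbitrary graphs K. *)
Definition deck_mult (G K : sgraph) : nat :=
  #|[set x : G | isomorphic (del [set x]) K]|.

Definition same_deck (G G' : sgraph) : Prop := deck_mult G =1 deck_mult G'.

Definition reconstructible (G : sgraph) : Prop :=
  forall G' : sgraph, same_deck G' G -> isomorphic G' G.

Definition graph_aut (H : sgraph) : {set {perm H}} :=
  [set p : {perm H} | [forall x, forall y, edge (p x) (p y) == edge x y]].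

Definition has_path (H : sgraph) (n : nat) (a b : H) : bool :=
  [exists p : n.-tuple H,
    [&& path (@edge H) a p, uniq (a :: p) & last a p == b]].

(* Distances are extended naturals: None stands for infinity, and [oAC minnA minnC] is
   the minimum on [option nat] with None as largest element.  A path of length
   n has n.+1 distinct vertices, so bounding n by the order loses no path. *)
Definition dist (H : sgraph) (a b : H) : option nat :=
  \big[oAC minnA minnC/None]_(n < #|H| | has_path n a b) Some (n : nat).

Definition delta (H : sgraph) (A B : {set H}) : option nat :=
  omap (addn 2) (\big[oAC minnA minnC/None]_(a in A) \big[oAC minnA minnC/None]_(b in B) dist a b).

Definition nbhd (G : sgraph) (v : G) : {set G} := [set x | edge v x].

(* N(v) :&: S, as a set of vertices of the induced subgraph on S *)
Definition trace (G : sgraph) (S : {set G}) (v : G) : {set induced S} :=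
  [set x : {x : G | x \in S} | val x \in nbhd v].

Definition distance_specifies_position (H : sgraph) (s t : {set H}) : Prop :=
  forall A B : {set H},
    (exists2 p : {perm H}, p \in graph_aut H & A = p @: s) ->
    (exists2 q : {perm H}, q \in graph_aut H & B = q @: t) ->
    delta A B = delta s t ->
    exists2 r : {perm H}, r \in graph_aut H
      & perm_eq [:: r @: A; r @: B] [:: s; t].

(* Main.v *)
Require Import Defs.
From mathcomp Require Import all_boot perm.

Set Implicit Arguments.
Unset Strict Implicit.
Unset Printing Implicit Defensive.

(** Let G' have the same deck as G, and fix a bijection s from G to G' under
    which corresponding vertex-deleted subgraphs are isomorphic.  The proof
    recovers in G', piece by piece, everything that determines G.

    The anchor.  By Kelly's lemma ([kelly]) G and G' contain equally many
    induced copies of every graph with fewer vertices than G.  In particular H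
    has a single copy in G'.  The cards of G that contain H are those of v and
    w, so the copy of H in G' avoids s v and s w, and its vertex set is the
    complement of that pair ([hypomorphism_anchor]).

    The traces up to symmetry.  An isomorphism from G \ w to G' \ s w maps the
    only copy of H onto the only copy of H, hence v to s v.  So after H and its
    copy in G' are identified, the neighbourhood A of s v in H is the image of
    s_v under an automorphism of H, and likewise the neighbourhood B of s w
    is an image of s_w ([trace_position]).

    The distance.  By inclusion and exclusion over the copies that avoid v,
    avoid w, or avoid both, G has as many copies of a smaller graph F through
    both v and w as G' has through both s v and s w ([card_copies_pair],
    [hypomorphism_copies_through]).  Taking for F the graph induced on {v, w}
    shows that v and w are adjacent exactly when s v and s w are.  Now let F be
    induced by a path from v to w with nonempty interior in H.  Its copy in G'
    shows s v and s w as two vertices x, y of F with the same adjacency as v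
    and w.  If they are nonadjacent, connectedness of F gives a path from x to
    y, which has an interior vertex; if they are adjacent, F has a Hamiltonian
    cycle, and one of the two arcs between x and y has an interior vertex
    ([detour_spanning]).  The path found is no longer than the given one, as it
    has no other vertices than F.  So s v and s w are at most as far apart
    within the copy of H as v and w within H.  Kelly's lemma does not reach the case where the path
    exhausts G, but then H is connected, so that any two nonempty sets of its
    vertices are at a distance smaller than the order of H
    ([delta_transfer]).  By symmetry the two distances agree.

    Gluing.  The hypothesis now provides an automorphism of H that takes
    {A, B} to {s_v, s_w}.  Together with the equality of the adjacencies inside
    the two pairs it extends to an isomorphism ([glue_isomorphic]). *)

(** * Permuted sequences and bijections *)

Lemma perm_eq_pair (T : eqType) (a b c d : T) :
  perm_eq [:: a; b] [:: c; d] -> (a = c /\ b = d) \/ (a = d /\ b = c).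
Proof.
move=> eab; have := perm_mem eab a; rewrite !inE eqxx /= => /esym/orP[]/eqP ac.
  left; move: eab; rewrite ac perm_cons => /perm_mem/(_ b).
  by rewrite !inE eqxx => /esym/eqP.
right; move: eab; rewrite ac perm_sym -[[:: c; d]]/([:: c] ++ [:: d]).
rewrite perm_catC perm_cons.
by move=> /perm_mem/(_ c); rewrite !inE eqxx => /esym/eqP.
Qed.

(** Two families over finite types that take each value equally often are
    matched by a bijection of their index types. *)
Lemma perm_map_bij (T T' : finType) (U : eqType) (c : T -> U) (c' : T' -> U) :
  perm_eq (map c (enum T)) (map c' (enum T')) ->
  exists2 s : T -> T', bijective s & forall x, c' (s x) = c x.
Proof.
move=> cc'; have eqn : #|T| = #|T'|.
  by rewrite !cardE -(size_map c) (perm_size cc') size_map.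
have /tuple_permP[p defc] :
  perm_eq (map c (enum T)) (map_tuple c' (enum_tuple T')) by [].
pose s x := enum_val (p (cast_ord eqn (enum_rank x))); exists s => [|x].
  apply: inj_card_bij; last by rewrite eqn.
  by move=> x y /enum_val_inj/perm_inj/cast_ord_inj/enum_rank_inj.
have /(congr1 (fun r => nth (c x) r (enum_rank x))) := defc.
rewrite (nth_map x) -?cardE ?nth_enum_rank // => ->.
rewrite -[nat_of_ord _]/(nat_of_ord (cast_ord eqn (enum_rank x))) -tnth_nth.
rewrite tnth_mktuple tnth_map (tnth_nth (s x)).
by rewrite [in LHS]/s (enum_val_nth (s x)).
Qed.

(** * Isomorphisms and embeddings *)

Definition embedding (K G : sgraph) (f : K -> G) : Prop :=
  injective f /\ {mono f : x y / edge x y}.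

Lemma isomorphic_refl (G : sgraph) : isomorphic G G.
Proof. by apply/isomorphicP; exists id => //; exists id. Qed.

Lemma isomorphic_sym (G H : sgraph) : isomorphic G H -> isomorphic H G.
Proof.
case/isomorphicP=> f [g fK gK] fE; apply/isomorphicP; exists g; first by exists f.
by move=> x y; rewrite -fE !gK.
Qed.

Lemma isomorphic_trans (G H K : sgraph) :
  isomorphic G H -> isomorphic H K -> isomorphic G K.
Proof.
case/isomorphicP=> f fB fE /isomorphicP[g gB gE]; apply/isomorphicP.
by exists (g \o f) => [|x y /=]; [apply: bij_comp | rewrite gE fE].
Qed.

Lemma isomorphic_eql (G H K : sgraph) :
  isomorphic G H -> isomorphic G K = isomorphic H K.
Proof.
move=> GH; apply/idP/idP; apply: isomorphic_trans => //.
exact: isomorphic_sym.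
Qed.

Lemma card_induced (G : sgraph) (S : {set G}) : #|induced S| = #|S|.
Proof. by rewrite card_sig; apply: eq_card. Qed.

Lemma isomorphic_card (G H : sgraph) : isomorphic G H -> #|G| = #|H|.
Proof. by case/isomorphicP=> f fB _; apply: bij_eq_card fB. Qed.

Lemma embedding_val (G : sgraph) (S : {set G}) :
  embedding (val : induced S -> G).
Proof. by split=> //; apply: val_inj. Qed.

Lemma embedding_comp (K G L : sgraph) (f : K -> G) (g : G -> L) :
  embedding f -> embedding g -> embedding (g \o f).
Proof. by case=> fI fE [gI gE]; split=> [|x y]; [apply: inj_comp | rewrite /= gE fE]. Qed.

Lemma image_val (G : sgraph) (S : {set G}) :
  (val : induced S -> G) @: setT = S.
Proof.
apply/setP=> x; apply/imsetP/idP => [[y _ ->]|xS]; first exact: (valP y).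
by exists (exist _ x xS : induced S).
Qed.

Lemma induced_imset (K G : sgraph) (f : K -> G) (S : {set K}) :
  embedding f -> isomorphic (induced S) (induced (f @: S)).
Proof.
case=> fI fE; have fS (x : induced S) : f (val x) \in f @: S.
  exact/imset_f/valP.
apply/isomorphicP.
exists (fun x => exist _ (f (val x)) (fS x) : induced (f @: S)) => [|x y].
  apply: inj_card_bij => [x y /(congr1 val) /= /fI /val_inj //|].
  by rewrite !card_induced card_imset.
exact: fE.
Qed.

Lemma image_isomorphic (K G : sgraph) (f : K -> G) :
  embedding f -> isomorphic (induced (f @: setT)) K.
Proof.
move=> fe; apply: isomorphic_trans (isomorphic_sym (induced_imset _ fe)) _.
apply/isomorphicP; exists val => //.
by exists (fun x => exist _ x (in_setT x)) => x //; apply: val_inj.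
Qed.

Lemma isomorphic_embedding (K G : sgraph) (S : {set G}) :
  isomorphic (induced S) K -> exists2 f : K -> G, embedding f & f @: setT = S.
Proof.
case/isomorphic_sym/isomorphicP=> f fB fE; exists (val \o f).
  by apply: embedding_comp (embedding_val S); split=> //; apply: bij_inj.
have [g _ gK] := fB; rewrite imset_comp (_ : f @: setT = setT) ?image_val //.
by apply/setP=> y; rewrite inE; apply/imsetP; exists (g y).
Qed.

(** * Copies of a graph and Kelly's lemma *)

(** Copies are vertex sets, so that an anchor is a set S which is the only
    element of [copies (induced S) G]. *)
Definition copies (F G : sgraph) : {set {set G}} :=
  [set S | isomorphic (induced S) F].

Lemma card_copy (F G : sgraph) (S : {set G}) : S \in copies F G -> #|S| = #|F|.
Proof. by rewrite inE => /isomorphic_card; rewrite card_induced. Qed.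

(** Copies inside an embedded graph correspond to copies in that graph by taking
    images; this is what allows counts in a card to be read as counts in G. *)
Lemma card_copies_sub (F K G : sgraph) (f : K -> G) :
  embedding f ->
  #|[set S in copies F G | S \subset f @: setT]| = #|copies F K|.
Proof.
move=> fe; have [fI _] := fe.
rewrite -(card_imset (copies F K) (imset_inj fI)); apply: eq_card => S.
rewrite !inE; apply/andP/imsetP => [[SF Sf]|[T + ->]]; last first.
  by rewrite inE (isomorphic_eql _ (induced_imset _ fe)) imsetS ?subsetT.
have defS : S = f @: (f @^-1: S).
  apply/setP=> y; apply/idP/imsetP => [yS|[x + ->]]; last by rewrite inE.
  by have /imsetP[x _ eyx] := subsetP Sf y yS; exists x; rewrite // inE -eyx.
exists (f @^-1: S) => //.
by rewrite inE (isomorphic_eql _ (induced_imset _ fe)) -defS.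
Qed.

Lemma card_copies_iso (F K L : sgraph) :
  isomorphic K L -> #|copies F K| = #|copies F L|.
Proof.
case/isomorphicP=> f fB fE; have [g _ gK] := fB.
rewrite -(@card_copies_sub F _ _ f); last by split=> //; apply: bij_inj.
apply: eq_card => S; rewrite inE [X in _ && X](_ : _ = true) ?andbT //.
by apply/subsetP=> y _; apply/imsetP; exists (g y).
Qed.

(** The bijective form of equality of decks, which makes it possible to follow
    individual vertices from one graph to the other. *)
Definition hypomorphism (G G' : sgraph) (s : G -> G') : Prop :=
  bijective s /\ forall x, isomorphic (del [set x]) (del [set s x]).

(** All cards of both graphs are sorted into isomorphism classes inside the
    disjoint union of the vertex sets.  Equality of the decks says that each
    class contains equally many cards of either graph. *)
Lemma same_deck_hypomorphism (G G' : sgraph) :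
  same_deck G' G -> exists s : G -> G', hypomorphism s.
Proof.
move=> deckE.
pose card_of (z : G + G') : sgraph :=
  match z with inl x => del [set x] | inr x => del [set x] end.
pose cls z := [set z' | isomorphic (card_of z) (card_of z')].
have clsE z z' : (cls z == cls z') = isomorphic (card_of z) (card_of z').
  apply/eqP/idP => [/setP/(_ z')|zz']; first by rewrite !inE isomorphic_refl.
  by apply/setP=> t; rewrite !inE (isomorphic_eql _ zz').
have clsK (T : finType) (i : T -> G + G') z :
    count_mem (cls z) (map (cls \o i) (enum T)) =
    #|[set x | isomorphic (card_of (i x)) (card_of z)]|.
  rewrite count_map -sum1_count big_enum_cond -sum1dep_card.
  by apply: eq_bigl => x; rewrite /= clsE.
have [|s sB sE] := @perm_map_bij G G' _ (cls \o inl) (cls \o inr).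
  apply/allP=> u; rewrite mem_cat => /orP.
  have sameE z : count_mem (cls z) (map (cls \o inl) (enum G)) =
                 count_mem (cls z) (map (cls \o inr) (enum G')).
    by rewrite !clsK; apply/esym/deckE.
  by case=> /mapP[x _ ->]; rewrite /= sameE.
exists s; split=> // x; apply: isomorphic_sym.
by rewrite -(clsE (inr (s x)) (inl x)); apply/eqP/sE.
Qed.

Lemma hypomorphism_card (G G' : sgraph) (s : G -> G') :
  hypomorphism s -> #|G| = #|G'|.
Proof. by case=> sB _; apply: bij_eq_card sB. Qed.

Lemma card_copies_del (F G : sgraph) (x : G) :
  #|[set S in copies F G | x \notin S]| = #|copies F (del [set x])|.
Proof.
rewrite -(card_copies_sub F (embedding_val (~: [set x]))) image_val.
by apply: eq_card => S; rewrite !inE subsetC sub1set inE.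
Qed.

Lemma copies_del (F G G' : sgraph) (s : G -> G') (x : G) : hypomorphism s ->
  #|[set S in copies F G | x \notin S]| = #|[set S in copies F G' | s x \notin S]|.
Proof. by case=> _ sE; rewrite !card_copies_del; apply: card_copies_iso. Qed.

(** Double counting of the pairs of a copy and a vertex outside it. *)
Lemma sum_copies_del (F G : sgraph) :
  \sum_x #|[set S in copies F G | x \notin S]| = #|copies F G| * (#|G| - #|F|).
Proof.
under eq_bigr => x _ do rewrite -sum1dep_card big_mkcondr.
rewrite exchange_big /= -sum_nat_const; apply: eq_bigr => S SF.
rewrite -big_mkcond sum1dep_card -(card_copy SF) -[in RHS](cardsC S) addKn.
by apply: eq_card => x; rewrite !inE.
Qed.

(** The sum of [sum_copies_del] depends only on the deck, and the factor
    [#|G| - #|F|] is positive, so that it can be cancelled. *)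
Lemma kelly (F G G' : sgraph) (s : G -> G') :
  hypomorphism s -> #|F| < #|G| -> #|copies F G| = #|copies F G'|.
Proof.
move=> sH FG; have cG := hypomorphism_card sH.
have [sB _] := sH.
apply/eqP; rewrite -(eqn_pmul2r (_ : 0 < #|G| - #|F|)) ?subn_gt0 //.
rewrite [in X in _ == X]cG -!sum_copies_del.
rewrite [X in _ == X](reindex s) /=; last exact: onW_bij.
by apply/eqP/eq_bigr => x _; apply: copies_del.
Qed.

(** Inclusion and exclusion, written without subtraction: the copies of F that
    avoid both v and w are the copies of F in K. *)
Lemma card_copies_pair (F K G : sgraph) (f : K -> G) (v w : G) :
  embedding f -> f @: setT = ~: [set v; w] ->
  #|[set S in copies F G | [set v; w] \subset S]| +
  (#|[set S in copies F G | v \notin S]| + #|[set S in copies F G | w \notin S]|)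
  = #|copies F G| + #|copies F K|.
Proof.
move=> fe fim.
pose C := copies F G; pose P := [set S : {set G} | [set v; w] \subset S].
rewrite -(card_copies_sub F fe) fim -cardsUI addnA -(cardsID P C).
congr (_ + _ + _); apply: eq_card => S; rewrite !inE.
- by rewrite andbC.
- by rewrite subUset !sub1set -andb_orr -negb_and andbC.
- by rewrite subsetC subUset !sub1set !inE; case: (isomorphic _ _).
Qed.

(** * Detours: paths with an interior vertex *)

(** [p] is the sequence of interior vertices of a path from x to y.  A possible
    edge from x to y is excluded by requiring an interior vertex, so that the
    distance of v and w within H is one more than the least size of [p]. *)
Definition detour (G : sgraph) (x y : G) (p : seq G) : bool :=
  [&& p != [::], path (@edge G) x (rcons p y) & uniq (x :: rcons p y)].

Lemma detour_map (K G : sgraph) (f : K -> G) (x y : K) (p : seq K) :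
  embedding f -> detour (f x) (f y) (map f p) = detour x y p.
Proof.
case=> fI fE; rewrite /detour -map_rcons -map_cons (map_inj_uniq fI).
by rewrite (mono_path fE); case: p.
Qed.

Lemma detour_sym (G : sgraph) (x y : G) (p : seq G) :
  detour x y p -> detour y x (rev p).
Proof.
case/and3P=> p0 xpy u; apply/and3P; split.
- by rewrite -size_eq0 size_rev size_eq0.
- have := rev_path (@edge G) x (rcons p y).
  rewrite last_rcons belast_rcons rev_cons => ->.
  by rewrite (eq_path (e' := @edge G)) // => a b; apply: edge_sym.
- by rewrite -[y :: _](_ : rev (x :: rcons p y) = _) ?rev_uniq // rev_cons rev_rcons.
Qed.

(** If x0 and y0 are nonadjacent then so are x and y, and any path between them
    has an interior vertex.  If x0 and y0 are adjacent, the detour closes to a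
    Hamiltonian cycle; having at least three vertices, it splits at x and y into
    two arcs that are not both without interior vertex. *)
Lemma detour_spanning (F : sgraph) (x0 y0 x y : F) (p0 : seq F) :
  detour x0 y0 p0 -> (forall z, z \in x0 :: rcons p0 y0) ->
  x != y -> edge x y = edge x0 y0 -> exists p, detour x y p.
Proof.
case/and3P=> p0N p0P p0U p0F neq_xy eq_e.
have [e0|e0] := boolP (edge x0 y0); last first.
  have x0c z : connect (@edge F) x0 z by apply: (path_connect p0P); apply: p0F.
  have : connect (@edge F) x y.
    apply: connect_trans (x0c y).
    by rewrite (sym_connect_sym (@edge_sym F)).
  case/connectP=> q0 /shortenP[q qP qU _ {q0}].
  case/lastP: q qP qU => [|q z] qP qU defy; first by rewrite defy eqxx in neq_xy.
  rewrite last_rcons in defy; subst z.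
  exists q; rewrite /detour qP qU !andbT; apply/eqP=> qN.
  by move: qP; rewrite qN /= eq_e (negPf e0).
have c0 : cycle (@edge F) (x0 :: rcons p0 y0).
  by rewrite /= rcons_path p0P last_rcons edge_sym.
have [i p1 p2 _ _ defc] := rot_to_arc p0U (p0F x) (p0F y) neq_xy.
have cU : uniq ((x :: p1) ++ y :: p2) by rewrite cat_cons -defc rot_uniq.
have : cycle (@edge F) (x :: p1 ++ y :: p2) by rewrite -defc rot_cycle.
rewrite /= rcons_cat rcons_cons -cat_rcons cat_path last_rcons => /andP[xp1 yp2].
have U1 : uniq (x :: rcons p1 y).
  by move: cU; rewrite cat_cons -cat_rcons -cat_cons cat_uniq => /andP[].
have U2 : uniq (y :: rcons p2 x).
  by move: cU; rewrite uniq_catC cat_cons -cat_rcons -cat_cons cat_uniq => /andP[].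
have [p1N|p1N] := eqVneq p1 [::]; last by exists p1; rewrite /detour p1N xp1.
have [p2N|p2N] := eqVneq p2 [::].
  have := congr1 size defc; rewrite size_rot p1N p2N /= size_rcons.
  by case: (p0) p0N.
by exists (rev p2); apply: detour_sym; rewrite /detour p2N yp2.
Qed.

(** * The distance within the anchor *)

Definition dist_le (d : option nat) (k : nat) : bool :=
  if d is Some m then m <= k else false.

Lemma dist_le_inj (d d' : option nat) : dist_le d =1 dist_le d' -> d = d'.
Proof.
case: d d' => [m|] [m'|] // dd'.
- congr Some; apply/anti_leq.
  by have := dd' m; have := dd' m'; rewrite /= !leqnn => -> <-.
- by have := dd' m; rewrite /= leqnn.
- by have := dd' m'; rewrite /= leqnn.
Qed.

Lemma dist_le_bigmin (I : finType) (P : pred I) (d : I -> option nat) (k : nat) :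
  dist_le (\big[oAC minnA minnC/None]_(i | P i) d i) k =
  [exists (i | P i), dist_le (d i) k].
Proof.
rewrite (big_morph (dist_le^~ k) (id1 := false) (op1 := orb)) //.
  by rewrite big_orE.
by move=> [m|] [m'|] //=; rewrite ?orbF // geq_min.
Qed.

(** The extended minimum is unfolded once and for all into the existence of a
    short path; distances are only compared through this equivalence. *)
Lemma delta_leP (H : sgraph) (A B : {set H}) (k : nat) :
  reflect (exists a p, [/\ a \in A, last a p \in B, path (@edge H) a p,
             uniq (a :: p) & size p + 2 <= k])
          (dist_le (delta A B) k).
Proof.
have -> : dist_le (delta A B) k = (1 < k) &&
    [exists a in A, exists b in B, exists n : 'I_#|H|,
      has_path n a b && (n <= k - 2)].
  rewrite /delta; set d := \big[_/_]_(_ in A) _.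
  transitivity ((1 < k) && dist_le d (k - 2)).
    case: d => [m|] /=; last by rewrite andbF.
    by case: k => [|[|k]] //=; rewrite subSS subn1 add2n.
  congr (_ && _); rewrite dist_le_bigmin; apply: eq_existsb => a; congr (_ && _).
  rewrite dist_le_bigmin; apply: eq_existsb => b; congr (_ && _).
  by rewrite dist_le_bigmin.
apply: (iffP andP) => [[k1 /existsP[a /andP[aA /existsP[b /andP[bB]]]]]|].
  case/existsP=> n /andP[/existsP[p /and3P[aP pU /eqP lp]] nk].
  by exists a, p; rewrite lp size_tuple addnC -leq_subRL.
case=> a [p [aA lB aP pU pk]]; have k1 : 1 < k by apply: leq_trans pk; rewrite addn2.
split=> //; apply/existsP; exists a; rewrite aA; apply/existsP; exists (last a p).
rewrite lB; have pn : size p < #|H|.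
  by have := card_uniqP pU => /= <-; apply: max_card.
apply/existsP; exists (Ordinal pn); rewrite leq_subRL //= addnC pk andbT.
by apply/existsP; exists (in_tuple p); rewrite aP pU eqxx.
Qed.

Lemma lift_seq (K G : sgraph) (f : K -> G) (s : seq G) :
  {subset s <= f @: setT} -> exists q, s = map f q.
Proof.
elim: s => [_|z s IHs sf]; first by exists [::].
have [|q ->] := IHs; first by move=> y ys; apply: sf; rewrite inE ys orbT.
by have /imsetP[x _ ->] := sf z (mem_head _ _); exists (x :: q).
Qed.

(** Here G is seen as the graph K, embedded by [f], together with two further
    vertices v and w.  The interior of a detour from v to w lies in K, and
    its first and last vertices belong to the traces of v and w. *)
Lemma delta_detour (K G : sgraph) (f : K -> G) (v w : G) (k : nat) :
  embedding f -> f @: setT = ~: [set v; w] -> v != w ->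
  dist_le (delta [set x | edge v (f x)] [set x | edge w (f x)]) k <->
  exists2 p, detour v w p & size p < k.
Proof.
move=> fe fim vw; have [fI fE] := fe.
have offP x : (f x != v) && (f x != w).
  have : f x \in f @: setT by apply: imset_f.
  by rewrite fim !inE negb_or.
have fNv s : v \notin map f s.
  by apply/mapP=> -[x _ evx]; have := offP x; rewrite -evx eqxx.
have fNw s : w \notin map f s.
  by apply/mapP=> -[x _ ewx]; have := offP x; rewrite -ewx eqxx andbF.
split=> [/delta_leP[a [p [aA lB aP pU pk]]]|[p /and3P[pN pP pU] pk]].
  exists (map f (a :: p)); last by rewrite size_map /= -addn2.
  move: aA lB; rewrite !inE => va wl; apply/and3P; split=> //.
    by rewrite rcons_path /= last_map va (mono_path fE) aP edge_sym.
  by rewrite cons_uniq rcons_uniq mem_rcons inE negb_or vw fNv fNw map_inj_uniq.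
move: pU; rewrite cons_uniq rcons_uniq mem_rcons inE negb_or => /and3P[/andP[_ vp] wp pU].
have [|q defp] := @lift_seq K G f p.
  move=> z zp; rewrite fim !inE negb_or.
  by apply/andP; split; [apply: contraNneq vp => <- | apply: contraNneq wp => <-].
case: q defp => [|a q] defp; first by rewrite defp in pN.
move: pP; rewrite defp rcons_path /= last_map (mono_path fE) => /andP[/andP[va aP] lw].
apply/delta_leP; exists a, q; split=> //.
- by rewrite inE.
- by rewrite inE edge_sym.
- by rewrite -(map_inj_uniq fI) -defp.
- by rewrite addn2; rewrite defp size_map in pk.
Qed.

(** * Copies through a pair of vertices *)

Definition copies_through (F G : sgraph) (v w : G) : {set {set G}} :=
  [set S in copies F G | [set v; w] \subset S].

Definition same_copies_through (G G' : sgraph) (v w : G) (v' w' : G') : Prop :=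
  forall F : sgraph, #|F| < #|G| ->
    #|copies_through F v w| = #|copies_through F v' w'|.

(** A small set S through v and w is itself a copy of [induced S], so some copy
    of [induced S] in G' passes through v' and w'.  The isomorphism need not
    match v with v', nor w with w', hence the unspecified x and y. *)
Lemma through_transfer (G G' : sgraph) (v w : G) (v' w' : G') (S : {set G}) :
  same_copies_through v w v' w' -> [set v; w] \subset S -> #|S| < #|G| ->
  exists (g : induced S -> G') x y, [/\ embedding g, g x = v' & g y = w'].
Proof.
move=> same vwS SG; have := same (induced S); rewrite card_induced => /(_ SG).
have : 0 < #|copies_through (induced S) v w|.
  by apply/card_gt0P; exists S; rewrite !inE isomorphic_refl.
move=> + eqc; rewrite eqc => /card_gt0P[S']; rewrite !inE subUset !sub1set.
case/and3P=> /isomorphic_embedding[g ge <-] /imsetP[x _ ->] /imsetP[y _ ->].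
by exists g, x, y.
Qed.

Lemma edge_transfer (G G' : sgraph) (v w : G) (v' w' : G') :
  same_copies_through v w v' w' -> v' != w' -> 2 < #|G| ->
  edge v w = edge v' w'.
Proof.
move=> same vw' G2.
have [|g [x [y [[_ gE] gx gy]]]] := through_transfer same (subxx _).
  by rewrite cards2; case: eqP => _ //; apply: ltnW.
rewrite -gx -gy gE.
have xy : val x != val y.
  by apply: contraNneq vw' => /val_inj exy; rewrite -gx -gy exy.
rewrite -[edge x y]/(edge (val x) (val y)).
have /set2P[ex|ex] := valP x; have /set2P[ey|ey] := valP y; move: xy;
  rewrite ex ey ?eqxx //.
by rewrite edge_sym.
Qed.

(** [detour_spanning] is applied to the graph induced by the vertices of the
    detour; the bound on the size holds because the new detour is a path
    inside a copy of that graph. *)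
Lemma detour_transfer (G G' : sgraph) (v w : G) (v' w' : G') (p : seq G) :
  same_copies_through v w v' w' -> v' != w' -> edge v w = edge v' w' ->
  detour v w p -> size p + 2 < #|G| ->
  exists2 p', detour v' w' p' & size p' <= size p.
Proof.
move=> same vw' eE pD pG; pose S := [set z in v :: rcons p w].
have cS : #|S| = size p + 2.
  have /and3P[_ _ pU] := pD.
  by rewrite cardsE (card_uniqP pU) /= size_rcons addn2.
have SE z : (z \in S) = (z \in v :: rcons p w) by rewrite inE.
clearbody S.
have [||g [x [y [ge gx gy]]]] := through_transfer (S := S) same.
- by rewrite subUset !sub1set !SE mem_head inE mem_rcons mem_head orbT.
- by rewrite cS.
have [i ie iS] := isomorphic_embedding (isomorphic_refl (induced S)).
have [|q] := @lift_seq _ _ i (v :: rcons p w).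
  by move=> z zp; rewrite iS SE.
case: q => [|x0 q] //; case/lastP: q => [|p0 y0]; first by case: (p).
rewrite map_cons map_rcons => -[ev /rcons_inj[ep ew]].
have D0 : detour x0 y0 p0.
  by rewrite -(detour_map _ _ _ ie) -ev -ep -ew.
have gE := ge.2; have [|||p1 D1] := detour_spanning (x := x) (y := y) D0.
- move=> z; have : i z \in S by rewrite -[S]iS imset_f.
  by rewrite SE ev ep ew -map_rcons -map_cons mem_map //; case: ie.
- by apply: contraNneq vw' => exy; rewrite -gx -gy exy.
- by rewrite -gE gx gy -eE ev ew ie.2.
exists (map g p1); first by rewrite -gx -gy detour_map.
have /and3P[_ _ /card_uniqP c1] := D1.
have := max_card (mem (x :: rcons p1 y)).
by rewrite c1 card_induced cS /= size_rcons addn2 size_map.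
Qed.

(** A detour that misses some vertex of G is transferred through copies.  A path
    between the traces that visits all of K instead makes K connected;
    the traces in G' are nonempty by the equality of cardinals, so some path of
    K joins them, and no path of K is longer than one visiting all of K. *)
Lemma delta_transfer (K G G' : sgraph) (f : K -> G) (f' : K -> G')
    (v w : G) (v' w' : G') (k : nat) :
  same_copies_through v w v' w' ->
  embedding f -> f @: setT = ~: [set v; w] -> v != w ->
  embedding f' -> f' @: setT = ~: [set v'; w'] -> v' != w' ->
  edge v w = edge v' w' ->
  #|[set x | edge v (f x)]| = #|[set x | edge v' (f' x)]| ->
  #|[set x | edge w (f x)]| = #|[set x | edge w' (f' x)]| ->
  dist_le (delta [set x | edge v (f x)] [set x | edge w (f x)]) k ->
  dist_le (delta [set x | edge v' (f' x)] [set x | edge w' (f' x)]) k.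
Proof.
move=> same fe fim vw fe' fim' vw' eE.
set A := [set _ | _]; set B := [set _ | edge w _].
set A' := [set _ | _]; set B' := [set _ | edge w' _] => cA cB dk.
have /delta_leP[a [p [aA lB aP pU pk]]] := dk.
(* The path, extended by v and w, has [size p + 3] vertices. *)
have [small|big] := ltnP (size p + 3) #|G|.
  have /(delta_detour _ fe fim vw)[q qD qp] : dist_le (delta A B) (size p + 2).
    by apply/delta_leP; exists a, p.
  have [|p' pD' pp'] := detour_transfer same vw' eE qD.
    by apply: leq_ltn_trans small; rewrite (addnS (size p)) addn2.
  apply/(delta_detour _ fe' fim' vw'); exists p' => //.
  by apply: leq_trans pk; apply: leq_ltn_trans qp.
have cK : #|K| + 2 = #|G|.
  rewrite -(cardsC [set v; w]) -fim card_imset ?cardsT; last by have [] := fe.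
  by rewrite cards2 vw addnC.
have cp : #|a :: p| = size p + 1 by rewrite (card_uniqP pU) addn1.
have leKp : #|K| <= #|a :: p|.
  by rewrite -(leq_add2r 2) cK cp -addnA.
have pK z : z \in a :: p.
  have /subset_cardP : #|a :: p| = #|K| by apply/eqP; rewrite eqn_leq max_card.
  by move=> /(_ (subset_predT _)) ->.
have conn x y : connect (@edge K) x y.
  have ac z := path_connect aP (pK z).
  by apply: connect_trans (ac y); rewrite (sym_connect_sym (@edge_sym K)).
have /card_gt0P[a' aA'] : 0 < #|A'| by rewrite -cA; apply/card_gt0P; exists a.
have /card_gt0P[b' bB'] : 0 < #|B'|.
  by rewrite -cB; apply/card_gt0P; exists (last a p).
have /connectP[q0 /shortenP[q qP qU _ {q0}] lq] := conn a' b'.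
apply/delta_leP; exists a', q; rewrite -lq; split=> //.
have := max_card (mem (a' :: q)); rewrite (card_uniqP qU) => /leq_trans/(_ leKp).
rewrite cp /= addn1 ltnS => qp.
by apply: leq_trans pk; rewrite leq_add2r.
Qed.

(** * Gluing along the anchor *)

Lemma same_image_aut (K G : sgraph) (f g : K -> G) :
  embedding f -> embedding g -> f @: setT = g @: setT ->
  exists2 p : {perm K}, p \in graph_aut K & forall x, f (p x) = g x.
Proof.
move=> [fI fE] [gI gE] fg.
have /fin_all_exists[h hE] x : exists y, f y = g x.
  have : g x \in f @: setT by rewrite fg imset_f.
  by case/imsetP=> y _ ->; exists y.
have hI : injective h by move=> x y /(congr1 f); rewrite !hE => /gI.
exists (perm hI) => [|x]; last by rewrite permE.
rewrite inE; apply/forallP=> x; apply/forallP=> y.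
by rewrite !permE -fE !hE gE.
Qed.

(** Stated as the existence of one extended map, so that its inverse is
    obtained by exchanging the roles of the two graphs. *)
Lemma glue_fun (K G G' : sgraph) (f : K -> G) (f' : K -> G')
    (v w : G) (v' w' : G') :
  injective f -> f @: setT = ~: [set v; w] -> v != w ->
  exists h : G -> G', [/\ h v = v', h w = w' & forall x, h (f x) = f' x].
Proof.
move=> fI fim vw.
have offP x : f x != v /\ f x != w.
  have : f x \in f @: setT by apply: imset_f.
  by rewrite fim !inE negb_or => /andP.
have /fin_all_exists[h hE] z : exists u : G',
    [/\ z = v -> u = v', z = w -> u = w' & forall x, z = f x -> u = f' x].
  have [zv|zv] := eqVneq z v.
    exists v'; split=> // [zw|x zx]; first by rewrite -zv zw eqxx in vw.
    by have [] := offP x; rewrite -zx zv eqxx.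
  have [zw|zw] := eqVneq z w.
    exists w'; split=> // [/eqP|x zx]; first by rewrite (negPf zv).
    by have [_] := offP x; rewrite -zx zw eqxx.
  have : z \in f @: setT by rewrite fim !inE negb_or zv.
  case/imsetP=> x _ zx; exists (f' x); split=> [/eqP|/eqP|y].
  - by rewrite (negPf zv).
  - by rewrite (negPf zw).
  - by rewrite zx => /fI ->.
exists h; split; first by have [->] := hE v.
  by have [_ ->] := hE w.
by move=> x; have [_ _] := hE (f x); apply.
Qed.

Lemma glue_isomorphic (K G G' : sgraph) (f : K -> G) (f' : K -> G')
    (v w : G) (v' w' : G') :
  embedding f -> f @: setT = ~: [set v; w] -> v != w ->
  embedding f' -> f' @: setT = ~: [set v'; w'] -> v' != w' ->
  (forall x, edge v (f x) = edge v' (f' x)) ->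
  (forall x, edge w (f x) = edge w' (f' x)) ->
  edge v w = edge v' w' -> isomorphic G G'.
Proof.
move=> [fI fE] fim vw [fI' fE'] fim' vw' vE wE eE.
have [h [hv hw hf]] := glue_fun f' v' w' fI fim vw.
have [h' [hv' hw' hf']] := glue_fun f v w fI' fim' vw'.
have spanP (H : sgraph) (k : K -> H) (a b : H) : k @: setT = ~: [set a; b] ->
    forall z, [\/ z = a, z = b | exists x, z = k x].
  move=> kim z; have [|za] := eqVneq z a; first by constructor 1.
  have [|zb] := eqVneq z b; first by constructor 2.
  have : z \in k @: setT by rewrite kim !inE negb_or za.
  by case/imsetP=> x _ ->; constructor 3; exists x.
apply/isomorphicP; exists h.
  exists h' => z.
    by case: (spanP _ _ _ _ fim z) => [->|->|[x ->]]; rewrite ?hv ?hw ?hf.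
  by case: (spanP _ _ _ _ fim' z) => [->|->|[x ->]]; rewrite ?hv' ?hw' ?hf'.
move=> x y; case: (spanP _ _ _ _ fim x) => [->|->|[{}x ->]];
  case: (spanP _ _ _ _ fim y) => [->|->|[{}y ->]];
  rewrite ?hv ?hw ?hf ?edge_irrefl ?fE ?fE' ?vE ?wE ?eE //.
- by rewrite edge_sym -eE edge_sym.
- by rewrite edge_sym -vE edge_sym.
- by rewrite edge_sym -wE edge_sym.
Qed.

(** * Transport of the anchor along a hypomorphism *)

(** An isomorphism from G \ w to G' \ s w, restricted to S, is an embedding
    into G' whose image is the unique copy; it differs from [f] by an
    automorphism, and sends v to the one remaining vertex s v. *)
Lemma trace_position (G G' : sgraph) (s : G -> G') (v w : G) (S : {set G})
    (f : induced S -> G') :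
  hypomorphism s -> S = ~: [set v; w] -> v != w ->
  embedding f -> f @: setT = ~: [set s v; s w] ->
  (forall T, T \in copies (induced S) G' -> T = ~: [set s v; s w]) ->
  exists2 p : {perm induced S}, p \in graph_aut (induced S)
    & [set x | edge (s v) (f x)] = p @: trace S v.
Proof.
move=> [_ sE] defS vw fe fim uniqS.
have /isomorphicP[h hB hE] := sE w.
have Sw x : x \in S -> x \in ~: [set w].
  by rewrite defS !inE negb_or => /andP[].
have vNw : v \in ~: [set w] by rewrite !inE.
pose iS (x : induced S) : del [set w] := exist _ (val x) (Sw _ (valP x)).
have ie : embedding iS by split=> // x y /(congr1 val) /= /val_inj.
have he : embedding h by split=> //; apply: bij_inj.
have ge := embedding_comp (embedding_comp ie he) (embedding_val _).
set g := (X in embedding X) in ge.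
have gim : g @: setT = ~: [set s v; s w].
  by apply: uniqS; rewrite inE image_isomorphic.
pose u := h (exist _ v vNw).
(* The image of v avoids s w and, by injectivity, the copy of the anchor. *)
have uv : val u = s v.
  have : val u \notin g @: setT.
    apply/imsetP=> -[x _ /val_inj/(bij_inj hB)/(congr1 val) /= vx].
    by have : v \in S; [rewrite (vx : v = val x); apply: valP | rewrite defS !inE eqxx].
  have := valP u; rewrite gim !inE negbK => /negPf ->.
  by rewrite orbF => /eqP.
have [|p pA pE] := same_image_aut fe ge; first by rewrite fim gim.
exists p => //; apply/setP=> y; rewrite -[y](permKV p) (mem_imset _ _ perm_inj).
by rewrite !inE pE -uv [LHS]hE.
Qed.

Lemma hypomorphism_copies_through (K G G' : sgraph) (s : G -> G') (v w : G)
    (f : K -> G) (f' : K -> G') :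
  hypomorphism s -> embedding f -> f @: setT = ~: [set v; w] ->
  embedding f' -> f' @: setT = ~: [set s v; s w] ->
  same_copies_through v w (s v) (s w).
Proof.
move=> sH fe fim fe' fim' F FG; apply/eqP.
have := card_copies_pair F fe fim; have := card_copies_pair F fe' fim'.
rewrite -(kelly sH FG) -!(copies_del F _ sH) => <- /eqP.
by rewrite eqn_add2r.
Qed.

(** For x in {v, w}, the cards of x and s x contain equally many copies of the
    anchor, namely one; hence the only copy in G' avoids both s v and s w. *)
Lemma hypomorphism_anchor (G G' : sgraph) (s : G -> G') (v w : G) :
  hypomorphism s -> v != w -> anchor (~: [set v; w]) ->
  copies (induced (~: [set v; w])) G' = [set ~: [set s v; s w]].
Proof.
move=> sH vw [_ _ uniqS]; set S := ~: [set v; w] in uniqS *.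
have cS : #|S| + 2 = #|G| by rewrite -(cardsC S) setCK cards2 vw.
have copiesG : copies (induced S) G = [set S].
  apply/setP=> T; rewrite !inE; apply/idP/eqP => [/uniqS //|->].
  exact: isomorphic_refl.
have /cards1P[S' defS'] : #|copies (induced S) G'| == 1.
  by rewrite -(kelly sH) ?copiesG ?cards1 // card_induced -cS addn2 ltnW.
have S'N x : x \in [set v; w] -> s x \notin S'.
  move=> xvw; have := copies_del (induced S) x sH.
  rewrite copiesG defS' (_ : [set T in [set S] | _] = [set S]); last first.
    by apply/setP=> T; rewrite !inE; case: eqP => // ->; rewrite inE xvw.
  rewrite cards1 => /esym/eqP/cards1P[T /setP/(_ T)].
  by rewrite !inE eqxx => /andP[/eqP->].
rewrite defS'; congr [set _]; apply/eqP; rewrite eqEcard; apply/andP; split.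
  by rewrite subsetC subUset !sub1set !inE !S'N ?set21 ?set22.
have := card_copy (_ : S' \in copies (induced S) G'); rewrite defS' set11.
move=> ->; rewrite // card_induced -(leq_add2r 2) cS (hypomorphism_card sH).
have sI : injective s by apply: bij_inj; case: sH.
by rewrite -(cardsC [set s v; s w]) cards2 (inj_eq sI) vw addnC.
Qed.

Theorem theorem2 (G : sgraph) (v w : G) (hvw : v <> w)
  (hanchor : anchor (~: [set v; w]))
  (hpos : distance_specifies_position
            (trace (~: [set v; w]) v) (trace (~: [set v; w]) w)) :
  reconstructible G.
Proof.
move=> G' /same_deck_hypomorphism[s sH]; have vw : v != w by apply/eqP.
have cG := hypomorphism_card sH.
have vw' : s v != s w by rewrite (inj_eq (bij_inj sH.1)).
have copiesG' := hypomorphism_anchor sH vw hanchor.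
set S := ~: [set v; w] in hanchor hpos copiesG'.
have SE : ~: [set w; v] = S by rewrite setUC.
have [f' fe' fim'] : exists2 f' : induced S -> G',
    embedding f' & f' @: setT = ~: [set s v; s w].
  by apply: isomorphic_embedding; have := set11 (~: [set s v; s w]);
    rewrite -copiesG' inE.
have uniqS T : T \in copies (induced S) G' -> T = ~: [set s v; s w].
  by rewrite copiesG' => /set1P.
have fe := embedding_val S; have fim := image_val S.
have same := hypomorphism_copies_through sH fe fim fe' fim'.
have G2 : 2 < #|G|.
  case: hanchor => S0 _ _; move: S0; rewrite -card_gt0 => S0.
  by rewrite -(cardsC S) setCK cards2 vw addn2.
have eE := edge_transfer same vw' G2.
pose A := [set x | edge (s v) (f' x)]; pose B := [set x | edge (s w) (f' x)].
have [p pA defA] := trace_position sH (erefl S) vw fe' fim' uniqS.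
have [q qA defB] : exists2 q : {perm induced S}, q \in graph_aut (induced S)
    & B = q @: trace S w.
  apply: (trace_position sH (esym SE)); rewrite 1?eq_sym //.
    by rewrite [[set s w; _]]setUC.
  by rewrite [[set s w; _]]setUC.
have trE u : trace S u = [set x | edge u (val x)].
  by apply/setP=> x; rewrite !inE.
have deltaE : delta A B = delta (trace S v) (trace S w).
  have cA : #|A| = #|[set x : induced S | edge v (val x)]|.
    by rewrite /A defA card_imset ?trE //; apply: perm_inj.
  have cB : #|B| = #|[set x : induced S | edge w (val x)]|.
    by rewrite defB card_imset ?trE //; apply: perm_inj.
  have same' : same_copies_through (s v) (s w) v w.
    by move=> F; rewrite -cG => /same.
  apply: dist_le_inj => k; rewrite !trE; apply/idP/idP.
    exact: (delta_transfer same' fe' fim' vw' fe fim vw).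
  exact: (delta_transfer same fe fim vw fe' fim' vw').
have [r rA rE] := hpos A B (ex_intro2 _ _ p pA defA) (ex_intro2 _ _ q qA defB) deltaE.
have re : embedding (r : induced S -> induced S).
  split; first exact: perm_inj.
  by move: rA; rewrite inE => /forallP rA x y; apply/eqP/(forallP (rA x)).
have fre := embedding_comp re fe.
have frim : (val \o r) @: setT = S.
  rewrite imset_comp (_ : r @: setT = setT) ?image_val //.
  by apply/setP=> x; rewrite inE -[x](permKV r) imset_f.
have posE (C : {set induced S}) u (x : induced S) :
    r @: C = trace S u -> edge u (val (r x)) = (x \in C).
  move=> rC; rewrite -(mem_imset C x (@perm_inj _ r)) rC.
  by rewrite !inE.
(* When the automorphism exchanges the two traces, s v plays the role of w and
   s w that of v. *)
have [rAB|rAB] : (r @: A = trace S v /\ r @: B = trace S w) \/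
                 (r @: A = trace S w /\ r @: B = trace S v).
  exact: perm_eq_pair.
- apply: (glue_isomorphic fe' fim' vw' fre frim vw) => // x.
  + by rewrite [RHS](posE A) ?inE //; case: rAB.
  + by rewrite [RHS](posE B) ?inE //; case: rAB.
- have wv : w != v by rewrite eq_sym.
  have frim' : (val \o r) @: setT = ~: [set w; v] by rewrite SE.
  apply: (glue_isomorphic fe' fim' vw' fre frim' wv) => [x|x|].
  + by rewrite [RHS](posE A) ?inE //; case: rAB.
  + by rewrite [RHS](posE B) ?inE //; case: rAB.
  + by rewrite [RHS]edge_sym eE.
Qed.
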